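(* There is a function $f(\cdot,\cdot,\cdot)$ such that, for every $\varepsilon>0$, every graph $G$ of highway dimension $\eta$ and every set $S$ of vertices of $G$, there exists a graph $H$ and an embedding $\phi$ of the vertices of $G$ into the vertices of $H$ such that $H$ has treewidth $f(\eta,|S|,\varepsilon)$, and for all vertices $u,v$ of $G$, $$d_G(u,v)\le d_H(\phi(u),\phi(v))\le (1+O(\varepsilon))\,d_G(u,v)+\varepsilon\min\big(d_G(S,u),d_G(S,v)\big).$$
   Context: Graphs are undirected with positive edge lengths; $d_G(u,v)$ is the shortest-path distance in $G$, $d_G(S,u)=\min_{x\in S}d_G(x,u)$, and $B_v(r)=\{u : d_G(u,v)\le r\}$. Fix a constant $c>4$. The highway dimension of $G$ is the smallest integer $\eta$ such that for every $r>0$ and every vertex $v$ there is a set of at most $\eta$ vertices in $B_v(cr)$ such that every shortest path contained in $B_v(cr)$ of length at least $r$ contains a vertex of this set. The $O(\varepsilon)$ term hides an absolute constant factor independent of $G$, $S$, $u$, $v$. *)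

(* Defs.v *)
From mathcomp Require Import all_boot all_order all_algebra.
From mathcomp Require Import boolp classical_sets reals constructive_ereal ereal.

Set Implicit Arguments.
Unset Strict Implicit.
Unset Printing Implicit Defensive.

Import Order.TTheory GRing.Theory Num.Theory.

Local Open Scope ring_scope.

Record wgraph (R : realType) := WGraph {
  vertex :> finType;
  adj : rel vertex;
  len : vertex -> vertex -> R;
  adj_sym : symmetric adj;
  adj_irr : irreflexive adj;
  len_sym : forall u v, len u v = len v u;
  len_gt0 : forall u v, adj u v -> 0 < len u v
}.

Section Distances.
Variables (R : realType) (G : wgraph R).
Implicit Types (u v : G) (p : seq G) (S : {set G}).

(* A path starting at [u] is given by the sequence [p] of its other vertices. *)
Fixpoint path_len u p : R :=
  if p is v :: p' then len u v + path_len v p' else 0.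

(* [+oo] when [u] and [v] lie in different components. Repeated vertices are
   allowed in [p]: as lengths are positive, this does not change the infimum,
   which is attained by a simple path as soon as some path exists. *)
Definition dist u v : \bar R :=
  ereal_inf [set l | exists p,
    [/\ path (@adj R G) u p, last u p = v & l = (path_len u p)%:E]].

(* [+oo] when [S] is empty. *)
Definition set_dist S u : \bar R := \big[Order.min/+oo%E]_(x in S) dist x u.

Definition gball v (r : R) : {set G} := [set u | (dist u v <= r%:E)%E].

Definition shortest_path u p : Prop :=
  path (@adj R G) u p /\ (path_len u p)%:E = dist u (last u p).

End Distances.

Section HighwayDimension.
Variables (R : realType) (c : R) (G : wgraph R).

Definition hubs_bounded (eta : nat) : Prop :=
  forall (r : R) (v : G), 0 < r ->
  exists X : {set G},
    [/\ (#|X| <= eta)%N, X \subset gball v (c * r) &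
      forall (u : G) (p : seq G), shortest_path u p ->
        {subset u :: p <= gball v (c * r)} -> r <= path_len u p ->
        exists2 x, x \in X & x \in u :: p].

Lemma hubs_bounded_ex : exists eta, `[< hubs_bounded eta >].
Proof.
exists #|G|; apply/asboolP => r v _; exists (gball v (c * r)); split => //.
  exact: max_card.
by move=> u p _ sub _; exists u; rewrite ?sub ?mem_head.
Qed.

Definition highway_dimension : nat := ex_minn hubs_bounded_ex.

End HighwayDimension.

Section Treewidth.

Definition is_tree (I : finType) (t : rel I) : Prop :=
  [/\ (0 < #|I|)%N, symmetric t, irreflexive t,
      forall i j, connect t i j
    & forall s, (2 < size s)%N -> ~ ucycle t s].

Variables (R : realType) (H : wgraph R).

Definition tree_decomposition (I : finType) (t : rel I) (B : I -> {set H}) :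
    Prop :=
  [/\ is_tree t,
      forall x, exists i, x \in B i,
      forall x y, adj x y -> exists i, x \in B i /\ y \in B i
    & forall x i j, x \in B i -> x \in B j ->
        connect [rel k l | [&& t k l, x \in B k & x \in B l]] i j].

(* Natural-number predecessor: the graph without vertices gets width 0. *)
Definition bags_width (I : finType) (B : I -> {set H}) : nat :=
  (\max_i #|B i|).-1.

Definition has_tree_decomposition (k : nat) : Prop :=
  exists (I : finType) (t : rel I) (B : I -> {set H}),
    tree_decomposition t B /\ bags_width B = k.

Lemma has_tree_decomposition_ex :
  exists k, `[< has_tree_decomposition k >].
Proof.
exists (bags_width (fun _ : unit => [set: H])); apply/asboolP.
exists unit, (fun _ _ => false), (fun _ => [set: H]%SET); split => //; split.
- split => //; first by rewrite card_unit.
    by move=> [] [].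
  by move=> [|[] [|[] s]].
- by move=> x; exists tt; rewrite inE.
- by move=> x y _; exists tt; rewrite !inE.
- by move=> x [] [].
Qed.

Definition treewidth : nat := ex_minn has_tree_decomposition_ex.

End Treewidth.

(* Main.v *)
Require Import Defs.
From mathcomp Require Import all_boot all_order all_algebra.
From mathcomp Require Import boolp classical_sets reals constructive_ereal ereal.
From mathcomp Require Import ring lra zify.

(**
  Fix geometrically decreasing scales r_0 > r_1 > ... of ratio lam, where
  1 < lam <= 2 and 2 lam <= c - 2. Call z isolated at level k if no vertex lies
  at a distance in [r_k, 2 r_k] from z; the open ball of radius r_k around z is
  then a town, and two vertices at distance < r_k lie in the same towns of
  level k. The towns of levels <= k therefore define a laminar family of
  classes, and u, v share their class of level k as soon as d(u,v) < r_k.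

  Suppose that x is within 2 r_k of u. If r_(k+1) <= d(u,w) <= 2 r_(k+1), the
  hubs of the ball of radius c r_(k+1) around x hit the shortest path from u to
  w. In particular, if u is not isolated at level k+1, one of these hubs is
  within 2 r_(k+1) of u. Iterating from S, or from the centre of the last town
  containing u, a bounded number of steps yields boundedly many hubs for each
  class, and these contain a vertex on the shortest path from u to v if
  r_(k+1) <= d(u,v) < r_k, and a vertex within 2 r_k of u in any case.

  The host graph consists of the vertices of G, a copy of S, and a copy of the
  hubs of each class. A vertex u is joined to S and to the hubs of its classes
  whose level is in a bounded window around the level of d(S,u). The forest of
  classes gives a tree decomposition of bounded width. Two vertices that are
  far apart compared with d(S,u) communicate through S, all others through a
  common hub.
*)

Set Implicit Arguments.
Unset Strict Implicit.
Unset Printing Implicit Defensive.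

Import Order.TTheory GRing.Theory Num.Theory.
Local Open Scope ring_scope.

(** * Trees given by a parent function *)

Section ParentTree.
Variables (I : finType) (par : I -> I) (rank : I -> nat) (root : I).
Hypothesis par_rank : forall i, i != root -> (rank (par i) < rank i)%N.

Definition parent_rel : rel I :=
  fun i j => (i != j) && ((par i == j) || (par j == i)).

Lemma parent_rel_sym : symmetric parent_rel.
Proof. by move=> i j; rewrite /parent_rel eq_sym orbC. Qed.

Lemma parent_rel_par i : i != root -> parent_rel i (par i).
Proof.
move=> /par_rank lt_i; rewrite /parent_rel eqxx andbT.
by apply: contraTneq lt_i => <-; rewrite ltnn.
Qed.

Hypothesis par_root : par root = root.

Lemma parent_rel_top i j :
  parent_rel i j -> (rank j <= rank i)%N -> j = par i.
Proof.
case/andP=> ij /orP[/eqP // | /eqP pj] le_ji.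
have [jr|/par_rank] := eqVneq j root.
  by case/eqP: ij; rewrite -pj jr par_root.
by rewrite pj ltnNge le_ji.
Qed.

(** Climbing along [par] inside [P] ends at [top], since ranks decrease. With [P] the nodes whose
    bag contains a given vertex, this is the connectivity condition of a tree decomposition. *)
Lemma parent_rel_connect (P : pred I) (top : I) :
  (forall i, P i -> i != top -> i != root /\ P (par i)) ->
  forall i j, P i -> P j ->
    connect [rel k l | [&& parent_rel k l, P k & P l]] i j.
Proof.
move=> Ppar.
set e := (X in connect X).
have to_top : forall i, P i -> connect e i top.
  move=> i; move: {2}(rank i) (leqnn (rank i)) => n.
  elim: n i => [|n IHn] i le_i Pi; have [->|itop] := eqVneq i top;
    do ?[exact: connect0]; have [iroot Ppi] := Ppar _ Pi itop;
    have lt_i := par_rank iroot.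
    by move: (leq_trans lt_i le_i).
  apply: connect_trans (connect1 _) (IHn (par i) _ Ppi).
    by rewrite /e /= parent_rel_par // Pi Ppi.
  by rewrite -ltnS (leq_trans lt_i).
have e_sym : connect_sym e.
  apply: sym_connect_sym => i j; rewrite /e /=.
  by rewrite parent_rel_sym (andbC (P i)).
move=> i j Pi Pj; apply: connect_trans (to_top _ Pi) _.
by rewrite e_sym to_top.
Qed.

(* A vertex of maximal rank on a cycle has its parent as both neighbours. *)
Lemma parent_rel_tree : is_tree parent_rel.
Proof.
split.
- by rewrite -cardsT card_gt0; apply/set0Pn; exists root.
- exact: parent_rel_sym.
- by move=> i; rewrite /parent_rel eqxx.
- move=> i j.
  have Ppar k : predT k -> k != root -> k != root /\ predT (par k) by [].
  have := parent_rel_connect Ppar (isT : predT i) (isT : predT j).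
  by apply: connect_sub => {}i {}j /= ij; apply: connect1; rewrite andbT in ij.
- move=> s s_gt2 /andP[cyc_s uniq_s].
  have [x0 x0s] : exists x, x \in s.
    by case: s s_gt2 {cyc_s uniq_s} => [|x s] //; exists x; rewrite mem_head.
  case: (arg_maxnP rank x0s) => x xs xmax.
  have [k s' def_s] := rot_to xs.
  have cyc' : cycle parent_rel (x :: s') by rewrite -def_s rot_cycle.
  have uniq' : uniq (x :: s') by rewrite -def_s rot_uniq.
  have size' : (2 < size (x :: s'))%N by rewrite -def_s size_rot.
  have max' y : y \in x :: s' -> (rank y <= rank x)%N.
    by rewrite -def_s mem_rot; apply: xmax.
  case: s' => [|a s'] // in def_s cyc' uniq' size' max' *.
  case/lastP: s' => [|s' b] // in def_s cyc' uniq' size' max' *.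
  move: cyc'; rewrite (cycle_path x) /= !rcons_path last_rcons.
  move=> /and3P[bx xa _].
  have ea : a = par x.
    by apply: parent_rel_top xa (max' _ _); rewrite !inE eqxx orbT.
  have eb : b = par x.
    rewrite parent_rel_sym in bx.
    apply: parent_rel_top bx (max' _ _).
    by rewrite !inE mem_rcons mem_head !orbT.
  by move: uniq'; rewrite /= mem_rcons ea eb mem_head /= andbF.
Qed.

End ParentTree.

(** * Walks and shortest-path distances *)

Section DistanceTheory.
Variables (R : realType) (G : wgraph R).
Implicit Types (u v w : G) (p q : seq G).

Notation walk := (path (@adj R G)).

Lemma path_len_cat u p q :
  path_len u (p ++ q) = path_len u p + path_len (last u p) q.
Proof. by elim: p u => [|v p IHp] u /=; rewrite ?add0r // IHp addrA. Qed.

Lemma path_len_ge0 u p : walk u p -> 0 <= path_len u p.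
Proof.
elim: p u => //= v p IHp u /andP[uv /IHp]; apply: addr_ge0.
exact/ltW/len_gt0.
Qed.

Lemma path_len_gt0 u p : walk u p -> last u p != u -> 0 < path_len u p.
Proof.
case: p => [|v p] /=; first by rewrite eqxx.
by move=> /andP[uv /path_len_ge0 vp] _; apply: ltr_wpDr => //; apply: len_gt0.
Qed.

Lemma path_rev u p : walk u p ->
  exists q, [/\ walk (last u p) q, last (last u p) q = u
              & path_len (last u p) q = path_len u p].
Proof.
elim: p u => [|v p IHp] u /=; first by exists [::].
move=> /andP[uv /IHp[q [wq lq eq]]]; exists (rcons q u).
rewrite rcons_path wq lq last_rcons -cats1 path_len_cat eq lq /=.
by rewrite adj_sym uv addr0 addrC len_sym.
Qed.

Lemma path_shorten u p : walk u p ->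
  exists q, [/\ walk u q, last u q = last u p, uniq (u :: q)
              & path_len u q <= path_len u p].
Proof.
elim: p u => [|v p IHp] u /=; first by exists [::].
move=> /andP[uv /IHp[q [wq lq uq le_q]]].
have [|nin] := boolP (u \in v :: q); last first.
  by exists (v :: q); split; rewrite ?[uniq _]/= ?nin //= ?uv // lerD2l.
rewrite inE => /predU1P[ev|uin].
  exists q; rewrite ev; split => //.
  by rewrite (le_trans le_q) // lerDr -ev; apply/ltW/len_gt0; rewrite ev in uv *.
case/splitPr: uin => q1 q2 in wq lq uq le_q *.
exists q2; move: wq lq uq le_q; rewrite cat_path last_cat /=.
move=> /and3P[w1 a1 w2] -> uq; rewrite path_len_cat /= => le_q; split=> //.
  by move: uq; rewrite /= cat_uniq => /andP[_ /and3P[_ _]].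
have := path_len_ge0 w1; have := ltW (len_gt0 a1); have := ltW (len_gt0 uv).
lra.
Qed.

Lemma dist_le_path u p : walk u p -> (dist u (last u p) <= (path_len u p)%:E)%E.
Proof. by move=> wp; apply: ereal_inf_lbound; exists p. Qed.

(** The infimum ranges over infinitely many walks, but shortening leaves sequences of length at most
    [#|G|]. These form a finite type, on which a minimum exists. *)
Lemma dist_attained u v : (dist u v < +oo)%E ->
  exists p, [/\ walk u p, last u p = v & dist u v = (path_len u p)%:E].
Proof.
move=> fin.
have [p0 [wp0 lp0]] : exists p, walk u p /\ last u p = v.
  apply: contrapT => none; move: fin; rewrite /dist.
  rewrite (_ : [set l | _]%classic = set0) ?ereal_inf0 ?ltxx //.
  by apply/seteqP; split=> // l [p [wp lp _]]; case: none; exists p.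
pose n := #|G|.
have short p : walk u p -> exists2 b : n.-bseq G,
    walk u b && (last u b == last u p) & path_len u b <= path_len u p.
  move=> /path_shorten[q [wq lq uq le_q]].
  have sz : (size q <= n)%N.
    by rewrite ltnW // -[(size q).+1]/(size (u :: q)) -(card_uniqP uq) max_card.
  by exists (Bseq sz); rewrite ?wq ?lq /=.
have [b0] := short _ wp0; rewrite lp0 => Pb0 _.
case: (@arg_minP _ _ _ b0 (fun b : n.-bseq G => walk u b && (last u b == v))
  (fun b => path_len u b) Pb0).
move=> b /andP[wb /eqP lb] bmin.
exists b; split => //; apply/le_anti/andP; split.
  by rewrite -lb dist_le_path.
apply: le_ereal_inf_tmp => _ [p [wp lp ->]]; rewrite lee_fin.
have [b' Pb' le_b'] := short _ wp; rewrite lp in Pb'.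
exact: le_trans (bmin _ Pb') le_b'.
Qed.

Lemma dist_ge0 u v : (0 <= dist u v)%E.
Proof.
by apply: le_ereal_inf_tmp => _ [p [wp _ ->]]; rewrite lee_fin path_len_ge0.
Qed.

Lemma dist_refl u : dist u u = 0%E.
Proof.
by apply/le_anti; rewrite dist_ge0 andbT; apply: ereal_inf_lbound; exists [::].
Qed.

Lemma dist_gt0 u v : u != v -> (0 < dist u v)%E.
Proof.
move=> uv; have [fin|] := ltP (dist u v) +oo%E; last by apply: lt_le_trans.
have [p [wp lp ->]] := dist_attained fin.
by rewrite lte_fin path_len_gt0 // lp eq_sym.
Qed.

Lemma dist_sym u v : dist u v = dist v u.
Proof.
wlog suff: u v / (dist u v <= dist v u)%E.
  by move=> W; apply/le_anti; rewrite !W.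
apply: le_ereal_inf_tmp => _ [p [wp lp ->]].
have [q [wq lq <-]] := path_rev wp; rewrite lp in wq lq *.
by rewrite -{1}lq dist_le_path.
Qed.

Lemma dist_triangle w u v : (dist u v <= dist u w + dist w v)%E.
Proof.
have nNy (x y : G) : dist x y != -oo%E.
  by rewrite gt_eqF // (lt_le_trans _ (dist_ge0 x y)) ?ltNy0.
have [fuw|] := ltP (dist u w) +oo%E; last first.
  by rewrite leye_eq => /eqP ->; rewrite addye // leey.
have [fwv|] := ltP (dist w v) +oo%E; last first.
  by rewrite leye_eq => /eqP ->; rewrite addey // leey.
have [p [wp lp ->]] := dist_attained fuw.
have [q [wq lq ->]] := dist_attained fwv.
rewrite -EFinD -lp -path_len_cat -{1}lq -{1}lp -last_cat; apply: dist_le_path.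
by rewrite cat_path wp lp.
Qed.

Lemma dist_fin u v x : (dist u v <= x%:E)%E -> dist u v = (fine (dist u v))%:E.
Proof.
move=> le_x; rewrite fineK // ge0_fin_numE ?dist_ge0 //.
exact: le_lt_trans le_x (ltry _).
Qed.

Lemma fine_dist_ge0 u v : 0 <= fine (dist u v).
Proof. exact/fine_ge0/dist_ge0. Qed.

Lemma dist_trans u w v x y : (dist u w <= x%:E)%E -> (dist w v <= y%:E)%E ->
  (dist u v <= (x + y)%:E)%E.
Proof.
move=> le_x le_y; apply: le_trans (dist_triangle w u v) _.
by rewrite EFinD leeD.
Qed.

Lemma shortest_path_mem u p y : shortest_path u p -> y \in u :: p ->
  (dist u y + dist y (last u p) <= (path_len u p)%:E)%E.
Proof.
move=> [wp _] yp; case/splitPl: yp => p1 p2 ly in wp *.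
move: wp; rewrite cat_path last_cat path_len_cat => /andP[w1 w2].
by rewrite EFinD leeD // ?ly -ly dist_le_path.
Qed.

End DistanceTheory.

(** * Canonical representatives of nested classes *)

Section ClassRepresentative.
Variables (T : finType) (L : eqType) (label : nat -> T -> L).

(** Members of a class of level [k] agree at all levels up to [k], not only at [k]; this makes the
    classes of successive levels nested. *)
Definition class_rep (k : nat) (u : T) : T :=
  odflt u [pick v | [forall j : 'I_k.+1, label j v == label j u]].

Lemma rep_label k j u : (j <= k)%N -> label j (class_rep k u) = label j u.
Proof.
rewrite -ltnS /class_rep => jk; case: pickP => //= v /forallP/(_ (Ordinal jk)).
by move/eqP.
Qed.

Lemma eq_rep k u v :
  (forall j, (j <= k)%N -> label j u = label j v) ->
  class_rep k u = class_rep k v.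
Proof.
move=> uv; rewrite /class_rep.
rewrite (@eq_pick _ _ (fun x => [forall j : 'I_k.+1, label j x == label j v])).
  by case: pickP => // /(_ v)/forallP[] j.
by move=> x; apply: eq_forallb => j; rewrite uv // -ltnS.
Qed.

Lemma rep_rep j k u : (j <= k)%N -> class_rep j (class_rep k u) = class_rep j u.
Proof.
by move=> jk; apply: eq_rep => i ij; rewrite rep_label // (leq_trans ij).
Qed.

End ClassRepresentative.

(** * The host graph and its tree decomposition *)

Section HubGraph.
Variables (R : realType) (G : wgraph R) (L : eqType) (label : nat -> G -> L).
Variables (N W g0 g : nat) (depth : G -> 'I_N.+1).
Variables (ghub : 'I_g0 -> G) (hub : nat -> G -> 'I_g -> G).
Variables (delta : R) (delta_gt0 : 0 < delta).

Local Notation rep := (class_rep label).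

(** [(j, w, i)] is a copy of hub number [i] of the class of level [j] represented by [w]. The middle
    summand indexes hubs common to all vertices, later the copies of [S]. *)
Definition hvertex : finType := (G + ('I_g0 + 'I_N.+1 * G * 'I_g))%type.
(** [None] is the root, [(k, w)] stands for the class of [w] at level [k], and each vertex [u] of
    [G] has a leaf below its class of level [depth u]. *)
Definition hnode : finType := option ('I_N.+1 * G + G)%type.
Implicit Types (u v w : G) (x y z : hvertex) (n : hnode).

Definition hpos z : G :=
  match z with
  | inl u => u
  | inr (inl i) => ghub i
  | inr (inr (j, w, i)) => hub j w i
  end.

(* The bag of the node [(k, w)]: a hub of level [j] stays in the bags of the
   descendants of its class for [W] levels. If [w] does not represent its class
   of level [k], then [(k, w)] is a leaf that serves no vertex of [G]. *)
Definition hclass (k : nat) w z : bool :=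
  match z with
  | inl _ => false
  | inr (inl _) => true
  | inr (inr (j, w', _)) =>
      (j <= k <= j + W)%N && (w' == if j == k :> nat then w else rep j w)
  end.

Definition hbag n : {set hvertex} :=
  match n with
  | None => [set z | if z is inr (inl _) then true else false]
  | Some (inl (k, w)) => [set z | hclass k w z]
  | Some (inr u) =>
      [set z | (z == inl u) || hclass (depth u) (rep (depth u) u) z]
  end.

Definition hparent n : hnode :=
  match n with
  | None => None
  | Some (inl (k, w)) =>
      if (k : nat) is k'.+1 then Some (inl (inord k', rep k' w)) else None
  | Some (inr u) => Some (inl (depth u, rep (depth u) u))
  end.

Definition hrank n : nat :=
  match n with
  | None => 0
  | Some (inl (k, _)) => k.+1
  | Some (inr _) => N.+2
  end.

Lemma hparent_rank n : n != None -> (hrank (hparent n) < hrank n)%N.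
Proof.
case: n => [[[[[|k] kN] w]|u]|] //= _; last by rewrite ltnS.
by rewrite inordK // ltnW.
Qed.

Definition htop z : hnode :=
  match z with
  | inl u => Some (inr u)
  | inr (inl _) => None
  | inr (inr (j, w, _)) => Some (inl (j, w))
  end.

(** Upwards, the window [j <= k <= j + W] can only be left from [k = j], and there the node is
    [htop z]. The condition on representatives survives by [rep_rep]. *)
Lemma hbag_parent z n : z \in hbag n -> n != htop z ->
  n != None /\ z \in hbag (hparent n).
Proof.
case: n => [[[k w]|u]|]; last first.
- by case: z => [?|[?|[[? ?] ?]]]; rewrite inE.
- case: z => [v|[i|[[j w'] i]]]; rewrite !inE //=.
  by rewrite orbF => /eqP[->]; rewrite eqxx.
case: z => [v|[i|[[j w'] i]]]; rewrite ?inE //.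
  by case: k => [[|k] kN] /= _ _; rewrite inE.
rewrite /= => /andP[/andP[jk kW]]; case: (eqVneq (j : nat) k) => [|njk].
  by move=> /val_inj <- /eqP ->; rewrite eqxx.
move=> /eqP -> _; case: k => [[|k] kN] /= in jk kW njk *; first by lia.
rewrite inE /= inordK; last by lia.
split=> //; have -> : (j <= k <= j + W)%N by lia.
have [->|nj] := eqVneq (j : nat) k; first exact: eqxx.
by rewrite rep_rep ?eqxx // -ltnS ltn_neqAle njk.
Qed.

(** Finiteness is required because [fine] sends [+oo] to 0, which would make the edge a shortcut
    between components. *)
Definition hlink x y : bool :=
  match x, y with
  | inl u, inr h => hclass (depth u) (rep (depth u) u) (inr h)
                    && (dist u (hpos (inr h)) < +oo)%E
  | _, _ => false
  end.

Definition hadj : rel hvertex := fun x y => hlink x y || hlink y x.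
(* Adding [delta] keeps the length positive between a vertex and its copies. *)
Definition hlen x y : R := fine (dist (hpos x) (hpos y)) + delta.

Lemma hadj_sym : symmetric hadj.
Proof. by move=> x y; rewrite /hadj orbC. Qed.

Lemma hadj_irr : irreflexive hadj.
Proof. by case. Qed.

Lemma hlen_sym x y : hlen x y = hlen y x.
Proof. by rewrite /hlen dist_sym. Qed.

Lemma hlen_gt0 x y : hadj x y -> 0 < hlen x y.
Proof. by move=> _; apply: ltr_wpDl => //; apply: fine_dist_ge0. Qed.

Definition hub_graph : wgraph R := WGraph hadj_sym hadj_irr hlen_sym hlen_gt0.

Definition hphi (u : G) : hub_graph := inl u : hvertex.

Lemma hphi_inj : injective hphi.
Proof. by move=> u v []. Qed.

Lemma hub_graph_decomposition :
  @tree_decomposition R hub_graph hnode (parent_rel hparent) hbag.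
Proof.
have link_bag x y : hlink x y -> exists n, x \in hbag n /\ y \in hbag n.
  case: x => [u|?] //; case: y => [?|h] //= /andP[hu _].
  by exists (Some (inr u)); rewrite !inE /= eqxx.
split.
- exact: (parent_rel_tree hparent_rank).
- move=> z; exists (htop z).
  case: z => [u|[i|[[j w] i]]]; rewrite /= inE //= ?eqxx //.
  by rewrite leqnn leq_addr.
- move=> x y /orP[/link_bag //|/link_bag[n [yn xn]]]; by exists n.
- move=> z i j.
  apply: (parent_rel_connect hparent_rank (P := fun n => z \in hbag n)).
  exact: hbag_parent.
Qed.

Lemma card_hclass k w :
  (k <= N)%N -> (#|[set z | hclass k w z]| <= g0 + W.+1 * g)%N.
Proof.
move=> kN.
(* In the second summand, [t] counts the levels from [k] up to that of the hub, so [W.+1] levels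
   contribute. *)
pose f (t : 'I_g0 + 'I_W.+1 * 'I_g) : hvertex :=
  match t with
  | inl i => inr (inl i)
  | inr (t, i) => inr (inr (inord (k - t),
      if t == 0%N :> nat then w else rep (k - t) w, i))
  end.
apply: leq_trans (_ : #|f @: [set: 'I_g0 + 'I_W.+1 * 'I_g]| <= _)%N; last first.
  apply: leq_trans (leq_imset_card _ _) _.
  by rewrite cardsT card_sum card_prod !card_ord.
apply/subset_leq_card/fintype.subsetP => -[?|[i|[[j w'] i]]];
  rewrite inE //= => H.
  by apply/imsetP; exists (inl i); rewrite ?inE.
case/andP: H => /andP[jk kW] /eqP ->.
have tW : (k - j < W.+1)%N by lia.
apply/imsetP; exists (inr (Ordinal tW, i)); rewrite ?inE //=.
have -> : (k - (k - j) = j)%N by lia.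
rewrite (_ : inord j = j); last by apply: val_inj; rewrite /= inordK.
by rewrite (_ : (k - j == 0)%N = (j == k :> nat)) //; lia.
Qed.

(** The leaf bag of a vertex may exceed the bound of [card_hclass] by that vertex alone, which the
    [-1] in the width absorbs. *)
Lemma treewidth_hub_graph : (treewidth hub_graph <= g0 + W.+1 * g)%N.
Proof.
rewrite /treewidth; case: ex_minnP => t _ tmin.
apply: leq_trans (tmin (bags_width (H := hub_graph) hbag) _) _.
  apply/asboolP; exists hnode, (parent_rel hparent), hbag; split => //.
  exact: hub_graph_decomposition.
rewrite /bags_width -subn1 leq_subLR add1n.
apply/bigmax_leqP => -[[[k w]|u]|] _ /=.
- by rewrite ltnW // ltnS card_hclass // -ltnS.
- have -> : [set z | (z == inl u) || hclass (depth u) (rep (depth u) u) z] =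
      inl u |: [set z : hvertex | hclass (depth u) (rep (depth u) u) z].
    by apply/setP => z; rewrite !inE.
  rewrite cardsU1 -[leqRHS]add1n leq_add ?card_hclass //; last by rewrite -ltnS.
  by case: (_ \notin _).
- apply: leq_trans (_ : _ <= g0 + W.+1 * g)%N _ => //.
  have [w _|_] := pickP (fun _ : G => true).
    apply: leq_trans (card_hclass w (leq0n N)).
    by apply/subset_leq_card/fintype.subsetP => -[?|[?|?]]; rewrite !inE.
  apply: leq_trans (leq_addr _ _); rewrite -[leqRHS]card_ord.
  rewrite -[leqRHS]cardsT.
  rewrite -(card_imset _ (inj_comp (@inr_inj G _)
    (@inl_inj _ ('I_N.+1 * G * 'I_g)%type))).
  apply/subset_leq_card/fintype.subsetP => -[?|[i|?]]; rewrite !inE // => _.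
  by apply/imsetP; exists i; rewrite ?inE.
Qed.

(** Each edge is at least as long as the distance in [G] between the positions of its ends; the
    triangle inequality sums this along a walk. *)
Lemma dist_le_hub_graph u v : (dist u v <= dist (hphi u) (hphi v))%E.
Proof.
apply: le_ereal_inf_tmp => _ [p [wp lp ->]].
rewrite -[u]/(hpos (hphi u)) -[v]/(hpos (hphi v)) -lp.
elim: p (hphi u) wp {lp} => [|y p IHp] x /=; first by rewrite dist_refl.
case/andP=> xy /IHp le_p; rewrite EFinD.
apply: le_trans (dist_triangle (hpos y) _ _) _; apply: leeD le_p.
have fin : (dist (hpos x) (hpos y) < +oo)%E.
  case/orP: xy; case: x y => [?|?] [?|?] //= /andP[_] //.
  by rewrite dist_sym.
rewrite -(@fineK _ (dist (hpos x) (hpos y))) ?ge0_fin_numE ?dist_ge0 //.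
by rewrite lee_fin lerDl ltW.
Qed.

Lemma hub_graph_two_hops u v (h : 'I_g0 + 'I_N.+1 * G * 'I_g) (a b : R) :
  hclass (depth u) (rep (depth u) u) (inr h) ->
  hclass (depth v) (rep (depth v) v) (inr h) ->
  (dist u (hpos (inr h)) <= a%:E)%E -> (dist (hpos (inr h)) v <= b%:E)%E ->
  (dist (hphi u) (hphi v) <= (a + b + 2 * delta)%:E)%E.
Proof.
move=> uh vh le_a le_b.
have uh' : hadj (inl u) (inr h).
  by rewrite /hadj /hlink uh (le_lt_trans le_a (ltry _)).
have hv' : hadj (inr h) (inl v).
  by rewrite hadj_sym /hadj /hlink vh dist_sym (le_lt_trans le_b (ltry _)).
have wp : path (@adj _ hub_graph) (hphi u) [:: inr h; inl v] by apply/and3P.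
apply: le_trans (dist_le_path wp) _.
rewrite lee_fin [path_len _ _]/= /hlen addr0 [hpos (inl u)]/= [hpos (inl v)]/=.
have := le_a; have := le_b; rewrite (dist_fin le_a) (dist_fin le_b) !lee_fin.
lra.
Qed.

(** Both leaf bags contain the copy of the hub: the class of level [j] is common, and both depths
    are at most [W] levels below [j]. *)
Lemma hub_graph_level u v (j : nat) (i : 'I_g) (a b : R) :
  (j <= depth u <= j + W)%N -> (j <= depth v <= j + W)%N ->
  rep j u = rep j v ->
  (dist u (hub j (rep j u) i) <= a%:E)%E ->
  (dist (hub j (rep j u) i) v <= b%:E)%E ->
  (dist (hphi u) (hphi v) <= (a + b + 2 * delta)%:E)%E.
Proof.
move=> ju jv ruv le_a le_b.
have jN : (j < N.+1)%N by have := ltn_ord (depth u); lia.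
have mem w : (j <= depth w <= j + W)%N ->
    hclass (depth w) (rep (depth w) w) (inr (inr (Ordinal jN, rep j w, i))).
  move=> jw; rewrite /= jw /=; have [<-|_] := eqVneq j (depth w).
    exact: eqxx.
  by rewrite rep_rep ?eqxx //; case/andP: jw.
apply: (@hub_graph_two_hops u v (inr (Ordinal jN, rep j u, i))) => //.
  exact: mem.
by rewrite ruv; apply: mem.
Qed.

Lemma hub_graph_global u v (i : 'I_g0) (a b : R) :
  (dist u (ghub i) <= a%:E)%E -> (dist (ghub i) v <= b%:E)%E ->
  (dist (hphi u) (hphi v) <= (a + b + 2 * delta)%:E)%E.
Proof. exact: (@hub_graph_two_hops u v (inl i)). Qed.

End HubGraph.

(** * Powers, unions and distances to a set *)

Lemma expr_unbounded (R : realType) (lam x : R) :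
  1 < lam -> exists n : nat, x <= lam ^+ n.
Proof.
move=> lam_gt1.
have bernoulli n : 1 + n%:R * (lam - 1) <= lam ^+ n.
  elim: n => [|n IHn]; first by rewrite mul0r addr0 expr0.
  rewrite exprS; have /(ler_wpM2l (ltW (lt_trans ltr01 lam_gt1))) := IHn.
  apply: le_trans; rewrite -natr1; have : 0 <= n%:R * (lam - 1) ^+ 2 :> R.
    by rewrite mulr_ge0 ?sqr_ge0.
  lra.
pose q := `|x| / (lam - 1).
have q_ge0 : 0 <= q by rewrite divr_ge0 // subr_ge0 ltW.
exists (Num.bound q); apply: le_trans (bernoulli _).
have lt_q := archi_boundP q_ge0.
have : `|x| <= (Num.bound q)%:R * (lam - 1).
  by rewrite -ler_pdivrMr ?subr_gt0 // ltW.
by have := ler_norm x; lra.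
Qed.

Lemma leq_card_bigcup (I T : finType) (P : pred I) (F : I -> {set T}) :
  (#|\bigcup_(i | P i) F i| <= \sum_(i | P i) #|F i|)%N.
Proof.
elim/big_rec2: _ => [|i n A _ le_n]; first by rewrite cards0.
by rewrite (leq_trans (leq_card_setU _ _)) // leq_add2l.
Qed.

Section SetDistance.
Variables (R : realType) (G : wgraph R) (S : {set G}).

Lemma set_dist_le s u : s \in S -> (set_dist S u <= dist s u)%E.
Proof. exact: (bigmin_le_cond _ (fun s => dist s u)). Qed.

Lemma set_dist_attained u :
  (0 < #|S|)%N -> exists2 s, s \in S & set_dist S u = dist s u.
Proof.
case/card_gt0P => s0 s0S.
have le_y s : s \in S -> (dist s u <= +oo)%E by move=> _; apply: leey.
by have [s sS eqs] := eq_bigmin s0 (mem S) _ s0S le_y; exists s.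
Qed.

End SetDistance.

(** * Geometric scales *)

Section Scales.
Variables (R : realType) (lam r0 : R).
Hypotheses (lam_gt1 : 1 < lam) (r0_gt0 : 0 < r0).

Definition scale (k : nat) : R := r0 / lam ^+ k.

Let lam_gt0 : 0 < lam. Proof. exact: lt_trans lam_gt1. Qed.

Lemma scale_gt0 k : 0 < scale k.
Proof. by rewrite divr_gt0 // exprn_gt0. Qed.

Lemma scaleD k m : scale k = lam ^+ m * scale (k + m).
Proof. by rewrite /scale exprD; field; rewrite !expf_neq0 // gt_eqF. Qed.

Lemma scaleS k : scale k = lam * scale k.+1.
Proof. by rewrite (scaleD k 1) addn1 expr1. Qed.

Lemma scale_le j k : (j <= k)%N -> scale k <= scale j.
Proof.
move=> /subnKC <-; rewrite [scale j](scaleD j (k - j)).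
by rewrite ler_peMl ?(ltW (scale_gt0 _)) // exprn_ege1 // ltW.
Qed.

Lemma scale_small x : 0 < x -> exists n, scale n < x.
Proof.
move=> x_gt0; have [n le_n] := expr_unbounded (2 * r0 / x) lam_gt1.
exists n; rewrite /scale ltr_pdivrMr ?exprn_gt0 //.
by rewrite ler_pdivrMr // mulrC in le_n; have := r0_gt0; lra.
Qed.

Lemma scale_bracket (P : pred R) :
  (exists n, P (scale n)) -> ~~ P r0 ->
  exists k, P (scale k.+1) && ~~ P (scale k).
Proof.
move=> exP nP0; case: (ex_minnP exP) => -[|k] Pk kmin.
  by move: nP0; rewrite -[r0]divr1 -(expr0 lam) -/(scale 0) Pk.
exists k; rewrite Pk; apply/negP => /kmin; by rewrite ltnn.
Qed.

End Scales.

(** * Towns and the hubs of a class *)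

Section Hubs.
Variables (R : realType) (G : wgraph R) (c lam r0 : R) (S : {set G}).
Hypotheses (lam_gt1 : 1 < lam) (lam_le2 : lam <= 2).
Hypotheses (lam_c : 2 * lam <= c - 2) (r0_gt0 : 0 < r0).
Implicit Types (u v w x z : G) (a i j k m t : nat) (Y : {set G}).

Local Notation r := (scale lam r0).
Let r_gt0 := scale_gt0 lam_gt1 r0_gt0.

Definition isolated k z : bool :=
  [forall w, (dist z w < (r k)%:E)%E || ((2 * r k)%:E < dist z w)%E].

(* The centre of the town of level [k] that contains [u], if there is one. *)
Definition center k u : option G :=
  [pick z | isolated k z && (dist u z < (r k)%:E)%E].

(** If [u] is in the town of [z], then [v] is at distance less than [2 * r k] from [z]; isolation of
    [z] then forces this distance below [r k]. *)
Lemma eq_center k u v : (dist u v < (r k)%:E)%E -> center k u = center k v.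
Proof.
move=> uv; apply: eq_pick => z /=; case: (boolP (isolated k z)) => //= iso.
wlog suff W : u v uv / (dist u z < (r k)%:E)%E -> (dist v z < (r k)%:E)%E.
  by apply/idP/idP; apply: W; rewrite // dist_sym.
move=> uz; move/forallP: iso => /(_ v) /orP[|]; first by rewrite dist_sym.
rewrite ltNge => /negP[]; rewrite mulr2n mulrDl mul1r.
by apply: dist_trans; [rewrite dist_sym|]; apply: ltW; eassumption.
Qed.

Lemma center_isolated k u : isolated k u ->
  exists2 z, center k u = Some z & (dist u z < (r k)%:E)%E.
Proof.
move=> iso; rewrite /center; case: pickP => [z /andP[_ uz]|/(_ u)].
  by exists z.
by rewrite iso dist_refl lte_fin r_gt0.
Qed.

Variables (eta : nat) (X : nat -> G -> {set G}).
Hypothesis X_card : forall k x, (#|X k x| <= eta)%N.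
Hypothesis X_hit : forall k x u p, shortest_path u p ->
  {subset u :: p <= gball x (c * r k)} -> r k <= path_len u p ->
  exists2 h, h \in X k x & h \in u :: p.

(** Step [m] adds hubs of scale [a + m] around every vertex found so far. Using all of them, rather
    than one near a given [u], keeps the set dependent on [Y] alone, so that a whole class can share
    it. *)
Fixpoint grow Y a m : {set G} :=
  if m is m'.+1 then
    grow Y a m' :|: \bigcup_(x in grow Y a m') X (a + m'.+1) x
  else Y.

Lemma card_grow Y a m : (#|grow Y a m| <= #|Y| * eta.+1 ^ m)%N.
Proof.
elim: m => [|m IHm]; first by rewrite muln1.
apply: leq_trans (leq_card_setU _ _) _.
apply: leq_trans (_ : #|grow Y a m| * eta.+1 <= _)%N; last first.
  by rewrite expnSr mulnA leq_mul2r IHm orbT.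
rewrite mulnS leq_add2l; apply: leq_trans (leq_card_bigcup _ _) _.
by rewrite -sum_nat_const leq_sum.
Qed.

Lemma grow_hit Y a m x u w : x \in grow Y a m ->
  (dist u x <= (2 * r (a + m))%:E)%E ->
  ((r (a + m).+1)%:E <= dist u w <= (2 * r (a + m).+1)%:E)%E ->
  exists2 h, h \in grow Y a m.+1 & (dist u h + dist h w <= dist u w)%E.
Proof.
move=> xY ux /andP[le_uw uw_le].
have [p [wp lp ep]] := dist_attained (le_lt_trans uw_le (ltry _)).
have sp : shortest_path u p by split; rewrite ?lp.
have mem y : y \in u :: p -> (dist u y + dist y w <= dist u w)%E.
  by move=> /(shortest_path_mem sp); rewrite lp ep.
have [||h hX hp] := @X_hit (a + m).+1 x u p sp.
- move=> y /mem yp; rewrite inE.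
  have yu : (dist y u <= (2 * r (a + m).+1)%:E)%E.
    rewrite dist_sym (le_trans _ uw_le) // (le_trans _ yp) // leeDl //.
    exact: dist_ge0.
  (* The bound is [2 * r (a + m).+1 + 2 * r (a + m)], that is, [2 + 2 * lam] times the finer scale,
     hence the condition [lam_c]. *)
  apply: le_trans (dist_trans yu ux) _; rewrite lee_fin.
  rewrite [r (a + m)](scaleS r0 lam_gt1).
  by have := r_gt0 (a + m).+1; move: lam_c; nra.
- by rewrite -lee_fin -ep.
exists h; last exact: mem.
by rewrite /= inE; apply/orP; right; apply/bigcupP; exists x; rewrite ?addnS.
Qed.

Definition starts k u : {set G} := S :|: [set z | center k u == Some z].

Lemma card_starts k u : (#|starts k u| <= #|S|.+1)%N.
Proof.
apply: leq_trans (leq_card_setU _ _) _; rewrite -addn1 leq_add2l.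
case: (center k u) => [z|]; last first.
  rewrite (_ : [set _ | _] = finset.set0) ?cards0 //;
    by apply/setP=> y; rewrite !inE.
rewrite (_ : [set _ | _] = [set z]) ?cards1 //;
  by apply/setP=> y; rewrite !inE eq_sym.
Qed.

(** Take the largest level [a <= k] at which some start is within [2 * r a] of [u]; [S] provides one
    at level [minn i k]. Between [a] and [k] the vertex [u] is never isolated, since the centre of
    its town would be a start at a larger level. So [grow_hit] applies at each of these levels. *)
Lemma near_hub i k u : (exists2 s, s \in S & (dist u s <= (r i)%:E)%E) ->
  exists a x, [/\ (minn i k <= a <= k)%N, x \in grow (starts a u) a (k - a)
    & (dist u x <= (2 * r k)%:E)%E].
Proof.
move=> [s sS us].
pose P a := (a <= k)%N && [exists y in starts a u, (dist u y <= (2 * r a)%:E)%E].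
have Pmin : P (minn i k).
  rewrite /P geq_minr; apply/exists_inP; exists s; first by rewrite inE sS.
  apply: le_trans us _; rewrite lee_fin.
  have := scale_le lam_gt1 r0_gt0 (geq_minl i k).
  by have := r_gt0 (minn i k); lra.
have Pk a : P a -> (a <= k)%N by case/andP.
have exP : exists a, P a by exists (minn i k).
case: (ex_maxnP exP Pk) => a /andP[ak /exists_inP[y ya uy]] amax.
suff [x xg ux] : exists2 x, x \in grow (starts a u) a (k - a)
    & (dist u x <= (2 * r (a + (k - a)))%:E)%E.
  by rewrite subnKC // in ux; exists a, x; rewrite amax // ak.
have : (a + (k - a) <= k)%N by rewrite subnKC.
elim: (k - a)%N => [|m IHm] le_k; first by exists y; rewrite ?addn0.
have [|x xg ux] := IHm; first by rewrite (leq_trans _ le_k) // leq_add2l.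
have : ~~ isolated (a + m.+1) u.
  apply/negP => /center_isolated[z cz uz].
  have : P (a + m.+1)%N.
    rewrite /P le_k; apply/exists_inP; exists z.
      by rewrite !inE cz eqxx orbT.
    apply: le_trans (ltW uz) _; rewrite lee_fin.
    by have := r_gt0 (a + m.+1); lra.
  by move/amax; rewrite addnS ltnNge leq_addr.
rewrite negb_forall => /existsP[w]; rewrite negb_or -!leNgt addnS => uw.
have [h hg le_h] := grow_hit xg ux uw.
exists h; rewrite ?addnS //; case/andP: uw => _; apply: le_trans.
by apply: le_trans le_h; rewrite leeDl // dist_ge0.
Qed.

(** Here [k - t] is the possible starting level. Growth runs one level past [k], to hit paths of
    length in [[r k.+1, r k)]. *)
Definition local_hubs (D : nat) k u : {set G} :=
  \bigcup_(t < D.+1 | (t <= k)%N) grow (starts (k - t) u) (k - t) t.+1.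

Lemma card_local_hubs D k u :
  (#|local_hubs D k u| <= D.+1 * (#|S|.+1 * eta.+1 ^ D.+1))%N.
Proof.
apply: leq_trans (leq_card_bigcup _ _) _.
rewrite -[X in (_ <= X * _)%N]card_ord -sum_nat_const.
rewrite big_mkcond; apply: leq_sum => t _; case: ifP => // _.
apply: leq_trans (card_grow _ _ _) _; apply: leq_mul (card_starts _ _) _.
by rewrite leq_pexp2l.
Qed.

(** The vertex enters only through its centres at levels at most [k], which are constant on its
    class. *)
Lemma local_hubs_rep D k u :
  local_hubs D k (class_rep center k u) = local_hubs D k u.
Proof.
by apply: eq_bigr => t _; rewrite /starts rep_label // leq_subr.
Qed.

Lemma mem_local_hubs D i k a u x : (minn i k <= a <= k)%N -> (k <= i + D)%N ->
  x \in grow (starts a u) a (k - a).+1 -> x \in local_hubs D k u.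
Proof.
move=> ak kD xg; have tD : (k - a < D.+1)%N by lia.
apply/bigcupP; exists (Ordinal tD); rewrite /= ?leq_subr //.
by rewrite subKn //; case/andP: ak.
Qed.

Lemma local_hub_near D i k u :
  (exists2 s, s \in S & (dist u s <= (r i)%:E)%E) -> (k <= i + D)%N ->
  exists2 x, x \in local_hubs D k u & (dist u x <= (2 * r k)%:E)%E.
Proof.
move=> /(near_hub k)[a [x [ak xg ux]]] kD; exists x => //.
by apply: mem_local_hubs ak kD _; rewrite /= inE xg.
Qed.

Lemma local_hub_hit D i k u v :
  (exists2 s, s \in S & (dist u s <= (r i)%:E)%E) -> (k <= i + D)%N ->
  ((r k.+1)%:E <= dist u v < (r k)%:E)%E ->
  exists2 x, x \in local_hubs D k u & (dist u x + dist x v <= dist u v)%E.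
Proof.
move=> /(near_hub k)[a [x [ak xg ux]]] kD /andP[le_uv uv_lt].
have eq_k : (a + (k - a) = k)%N by rewrite subnKC //; case/andP: ak.
have [| |h hg le_h] := @grow_hit _ _ _ _ u v xg; rewrite ?eq_k //.
  (* [r k] is at most [2 * r k.+1] because [lam <= 2], so [v] can serve as the witness [w] of
     [grow_hit]. *)
  rewrite le_uv (le_trans (ltW uv_lt)) // lee_fin (scaleS r0 lam_gt1 k).
  by rewrite ler_wpM2r // ltW.
by exists h => //; apply: mem_local_hubs ak kD _.
Qed.

End Hubs.

(** * Ranges of distances and of levels *)

Lemma dist_lower_bound (R : realType) (G : wgraph R) :
  exists2 m : R, 0 < m & forall u v : G, u != v -> (m%:E <= dist u v)%E.
Proof.
pose P (e : G * G) := (e.1 != e.2) && (dist e.1 e.2 < +oo)%E.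
exists (\big[Order.min/1]_(e | P e) fine (dist e.1 e.2)).
  apply: lt_bigmin => // e /andP[/dist_gt0 gt0 fin].
  by rewrite fine_gt0 // gt0.
move=> u v uv; have [fin|] := ltP (dist u v) +oo%E; last first.
  by apply: le_trans; apply: leey.
rewrite -[leRHS]fineK ?ge0_fin_numE ?dist_ge0 // lee_fin.
apply: (@bigmin_le_cond _ _ _ _ (u, v) P (fun e => fine (dist e.1 e.2))).
by rewrite /P uv.
Qed.

(** This gives the first scale: with [r0] above all finite distances, each positive one falls
    between two consecutive scales. *)
Lemma dist_upper_bound (R : realType) (G : wgraph R) :
  exists2 M : R, 0 < M &
    forall u v : G, (dist u v < +oo)%E -> (dist u v < M%:E)%E.
Proof.
pose B := \big[Order.max/0]_(e : G * G) fine (dist e.1 e.2).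
have B_ge0 : 0 <= B by apply: bigmax_ge_id.
exists (B + 1); first by rewrite ltr_wpDl.
move=> u v fin; rewrite -[ltLHS]fineK ?ge0_fin_numE ?dist_ge0 // lte_fin.
apply: le_lt_trans (_ : B < _); last by rewrite ltrDl.
exact: (@le_bigmax _ _ _ _ (fun e : G * G => fine (dist e.1 e.2)) (u, v)).
Qed.

(** Depths are levels shifted by [2 * D]. The shift puts both vertices below level [k], as
    [k <= iu + D <= iv + 2 * D], and window length [3 * D] suffices. *)
Lemma level_window (iu iv k D : nat) :
  (iv <= iu)%N -> (iu <= iv + D)%N -> (iu <= k + D)%N -> (k <= iu + D)%N ->
  (k <= iu + 2 * D <= k + 3 * D)%N /\ (k <= iv + 2 * D <= k + 3 * D)%N.
Proof. by lia. Qed.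

(** * Stretch of the embedding *)

Section Embedding.
Variables (R : realType) (c lam eps : R) (G : wgraph R) (S : {set G}).
Variables (eta D : nat).
Hypotheses (lam_gt1 : 1 < lam) (lam_le2 : lam <= 2) (lam_c : 2 * lam <= c - 2).
Hypotheses (eps_gt0 : 0 < eps) (lamD : 4 * lam * (1 + eps^-1) <= lam ^+ D).
Hypotheses (hubs : hubs_bounded c G eta) (S_gt0 : (0 < #|S|)%N).

Let good (H : wgraph R) (phi : G -> H) (u v : G) : Prop :=
  (dist (phi u) (phi v) <=
     (1 + 3 * eps)%:E * dist u v
     + eps%:E * Order.min (set_dist S u) (set_dist S v))%E.

(** The claim is symmetric and clear for [u = v]. An infinite term makes the right-hand side
    infinite; otherwise the distance from [S] to [v] is finite by the triangle inequality. *)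
Lemma good_suff (H : wgraph R) (phi : G -> H) :
  (forall u v (d a b : R), u != v -> dist u v = d%:E -> set_dist S u = a%:E ->
     set_dist S v = b%:E -> a <= b ->
     (dist (phi u) (phi v) <= ((1 + 3 * eps) * d + eps * a)%:E)%E) ->
  forall u v, good phi u v.
Proof.
move=> fin_good u v; rewrite /good.
wlog le_uv : u v / (set_dist S u <= set_dist S v)%E.
  move=> W; have /orP[/W //|/W] := le_total (set_dist S u) (set_dist S v).
  by rewrite (dist_sym (phi v)) (dist_sym v) minC.
have rho_ge0 w : (0 <= set_dist S w)%E.
  by have [s _ ->] := set_dist_attained w S_gt0; apply: dist_ge0.
have K_gt0 : 0 < 1 + 3 * eps by have := eps_gt0; lra.
rewrite (min_idPl le_uv).
have e_ge0 : (0 <= eps%:E * set_dist S u)%E by rewrite mule_ge0 // lee_fin ltW.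
have [<-|uv] := eqVneq u v.
  by rewrite !dist_refl mule0 add0e.
have := dist_ge0 u v; case duv : (dist u v) => [d| |] // _; last first.
  by rewrite gt0_muley ?lte_fin // addye ?leey // -ltNye (lt_le_trans _ e_ge0).
have := rho_ge0 u; case ru : (set_dist S u) => [a| |] // _; last first.
  by rewrite gt0_muley ?lte_fin // addey ?leey.
have rv : set_dist S v != +oo%E.
  have [s sS es] := set_dist_attained u S_gt0.
  have le_s : (dist s u <= a%:E)%E by rewrite -es ru.
  have le_d : (dist u v <= d%:E)%E by rewrite duv.
  rewrite -ltey; apply: le_lt_trans (set_dist_le v sS) _.
  exact: le_lt_trans (dist_trans le_s le_d) (ltry _).
have := rho_ge0 v; case rvb : (set_dist S v) rv => [b| |] // _ _.
rewrite -!EFinM -EFinD; apply: (fin_good u v d a b) => //.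
by rewrite -lee_fin -ru -rvb.
Qed.

Definition hub_bound : nat := (D.+1 * (#|S|.+1 * eta.+1 ^ D.+1))%N.

Lemma hub_embedding : exists (H : wgraph R) (phi : G -> H),
  [/\ injective phi, (treewidth H <= #|S| + (3 * D).+1 * hub_bound)%N
    & forall u v, (dist u v <= dist (phi u) (phi v))%E /\ good phi u v].
Proof.
have [dmin dmin_gt0 dminP] := dist_lower_bound G.
have [r0 r0_gt0 r0P] := dist_upper_bound G.
pose r := scale lam r0; have r_gt0 := scale_gt0 lam_gt1 r0_gt0.
have exX (kx : nat * G) : exists Y : {set G},
    (#|Y| <= eta)%N /\ forall u p, shortest_path u p ->
      {subset u :: p <= gball kx.2 (c * r kx.1)} -> r kx.1 <= path_len u p ->
      exists2 h, h \in Y & h \in u :: p.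
  by have [Y [? _ ?]] := hubs kx.2 (r_gt0 kx.1); exists Y.
have [X XP] := choice exX.
pose Xc k x := X (k, x).
have X_card k x : (#|Xc k x| <= eta)%N by case: (XP (k, x)).
have X_hit k x u p : shortest_path u p ->
    {subset u :: p <= gball x (c * r k)} -> r k <= path_len u p ->
    exists2 h, h \in Xc k x & h \in u :: p by case: (XP (k, x)) => _; apply.
(* The level of the distance from [S] to [u], left unspecified if that distance is 0 or infinite:
   such pairs fall under [good_suff] or the case [a <= eps * d]. *)
have ex_ring u : exists i : nat, forall a : R, 0 < a ->
    set_dist S u = a%:E -> r i.+1 < a <= r i.
  have [s sS ->] := set_dist_attained u S_gt0.
  have [pos|npos] := pselect (exists2 a : R, 0 < a & dist s u = a%:E); last first.
    by exists 0%N => a a_gt0 ea; case: npos; exists a.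
  case: pos => a a_gt0 ea.
  have [||i /andP[lt_a]] := @scale_bracket _ lam r0 (fun x => x < a).
  - exact: scale_small.
  - by rewrite -leNgt ltW // -lte_fin -ea r0P // ea ltry.
  - by rewrite -leNgt => a_le; exists i => b _; rewrite ea => -[<-]; rewrite lt_a.
have [ring ringP] := choice ex_ring.
pose N := (\max_u (ring u + 2 * D))%N.
pose depth u : 'I_N.+1 := inord (ring u + 2 * D).
have depthE u : depth u = (ring u + 2 * D)%N :> nat.
  rewrite inordK // ltnS.
  exact: (leq_bigmax (F := fun u => (ring u + 2 * D)%N)).
pose lh := local_hubs lam r0 S Xc D.
(* The default [w] pads the list of hubs to the uniform size [hub_bound]. *)
pose hub k w (i : 'I_hub_bound) := nth w (enum (lh k w)) i.
have hubP k w x : x \in lh k w -> exists i, hub k w i = x.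
  move=> xl; have lt_i : (index x (enum (lh k w)) < hub_bound)%N.
    apply: leq_trans (card_local_hubs lam r0 S X_card D k w).
    by rewrite cardE index_mem mem_enum.
  by exists (Ordinal lt_i); rewrite /hub nth_index // mem_enum.
pose ghub (i : 'I_#|S|) : G := enum_val i.
pose delta := eps * dmin / 2.
have delta_gt0 : 0 < delta by rewrite !mulr_gt0 // invr_gt0.
pose lab := center lam r0 (G := G).
exists (hub_graph lab (3 * D) depth ghub hub delta_gt0).
exists (@hphi _ _ _ _ _ _ _ _ _ _ _ _ _).
split.
- exact: hphi_inj.
- exact: treewidth_hub_graph.
move=> u v; split; first exact: dist_le_hub_graph.
apply: good_suff u v => u v d a b uv duv ru rv le_ab.
have delta_le : 2 * delta <= eps * d.
  have : dmin <= d by rewrite -lee_fin -duv dminP.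
  by move=> /(ler_wpM2l (ltW eps_gt0)); rewrite /delta; lra.
have d_ge0 : 0 <= d by rewrite -lee_fin -duv dist_ge0.
have d_gt0 : 0 < d by rewrite -lte_fin -duv dist_gt0.
have [s sS es] := set_dist_attained u S_gt0.
have us : (dist u s <= a%:E)%E by rewrite dist_sym -es ru.
have uv_le : (dist u v <= d%:E)%E by rewrite duv.
have a_ge0 : 0 <= a by rewrite -lee_fin -ru es dist_ge0.
(* If [a <= eps * d], the route through the nearest [s] in [S] costs [a + (a + d) + 2 * delta <= (1
   + 3 * eps) * d]. This is the source of the constant 3. *)
have [far|near] := leP a (eps * d).
  have sv : (dist s v <= (a + d)%:E)%E.
    by apply: dist_trans uv_le; rewrite dist_sym.
  rewrite -(enum_rankK_in sS sS) in us sv.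
  apply: le_trans (hub_graph_global _ _ _ _ _ us sv) _.
  rewrite lee_fin; have := mulr_ge0 (ltW eps_gt0) a_ge0; lra.
have a_gt0 : 0 < a by apply: le_lt_trans near; rewrite mulr_ge0 // ltW.
have b_le : b <= a + d.
  rewrite -lee_fin -rv; apply: le_trans (set_dist_le v sS) _.
  by apply: dist_trans uv_le; rewrite dist_sym.
have /andP[iu_lt iu_ge] := ringP u a a_gt0 ru.
have /andP[iv_lt iv_ge] := ringP v b (lt_le_trans a_gt0 le_ab) rv.
have d_lt : d < eps^-1 * a by rewrite ltr_pdivlMl // mulrC.
set q := eps^-1 in d_lt; pose P := lam ^+ D.
have lamP : 4 * lam * (1 + q) <= P by exact: lamD.
have q_gt0 : 0 < q by rewrite invr_gt0.
have P_gt0 : 0 < P by rewrite exprn_gt0 // (lt_trans _ lam_gt1).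
(* The choice of [D] is used twice: [P_ge] keeps the relevant levels within [D] of each other, and
   [P_eps] makes the scale of level [ring u + D] at most [eps * a / 4]. *)
have P_ge : 1 + q <= P.
  by apply: le_trans lamP; rewrite ler_peMl //; move: lam_gt1; lra.
have P_eps : 4 * lam <= eps * P.
  have := ler_wpM2l (ltW eps_gt0) lamP.
  have -> : eps * (4 * lam * (1 + q)) = eps * (4 * lam) + 4 * lam.
    by rewrite /q; field; rewrite gt_eqF.
  apply: le_trans; rewrite lerDr; apply: mulr_ge0; move: eps_gt0 lam_gt1; lra.
have iv_le : (ring v <= ring u)%N.
  rewrite leqNgt; apply/negP => /(scale_le lam_gt1 r0_gt0); rewrite -/r; lra.
(* Otherwise [P * a <= r (ring v).+1 < b <= a + d < (1 + q) * a], against [P_ge]. *)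
have iu_le : (ring u <= ring v + D)%N.
  rewrite leqNgt; apply/negP => /(scale_le lam_gt1 r0_gt0).
  rewrite -/r -addSn => le_i.
  have /(ler_wpM2l (ltW P_gt0)) := le_trans iu_ge le_i.
  rewrite -(scaleD r0 lam_gt1 (ring v).+1 D) -/r => lt_P.
  by have := ler_wpM2r (ltW a_gt0) P_ge; lra.
have near_u : exists2 s, s \in S & (dist u s <= (r (ring u))%:E)%E.
  by exists s => //; apply: le_trans us _; rewrite lee_fin.
(* It remains to find a level [k] within [D] of [ring u] and a local hub of [u] with detour at most
   [eps * a]. The bound [d < r k] puts [u] and [v] in the same class, which makes the hub common. *)
suff [k [ku kD dk [x xl [a1 [b1 [ux xv sum_le]]]]]] : exists k,
    [/\ (ring u <= k + D)%N, (k <= ring u + D)%N, d < r k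
      & exists2 x, x \in lh k u & exists a1 b1 : R, [/\ (dist u x <= a1%:E)%E,
          (dist x v <= b1%:E)%E & a1 + b1 <= d + eps * a]].
  have rep_uv : class_rep lab k u = class_rep lab k v.
    apply: eq_rep => j jk; apply: eq_center; rewrite duv lte_fin.
    exact: lt_le_trans dk (scale_le lam_gt1 r0_gt0 jk).
  have [i ei] : exists i, hub k (class_rep lab k u) i = x.
    by apply: hubP; rewrite /lh local_hubs_rep.
  rewrite -ei in ux xv.
  have [win_u win_v] := level_window iv_le iu_le ku kD.
  apply: le_trans (hub_graph_level ghub delta_gt0 _ _ rep_uv ux xv) _.
  - by rewrite depthE.
  - by rewrite depthE.
  - by rewrite lee_fin; lra.
(* For small [d], any hub within [2 * r (ring u + D)] of [u] will do: its detour is at most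
   [4 * r (ring u + D) <= eps * a]. *)
have [d_small|d_big] := ltP d (r (ring u + D)).
  exists (ring u + D)%N; split=> //; first by rewrite -addnA leq_addr.
  have [x xl ux] := local_hub_near lam_gt1 lam_le2 lam_c r0_gt0 X_hit near_u
    (leqnn (ring u + D)).
  exists x => //.
  exists (2 * r (ring u + D)), (2 * r (ring u + D) + d); split=> //.
    by apply: dist_trans uv_le; rewrite dist_sym.
  suff : 4 * r (ring u + D) <= eps * a by lra.
  rewrite -(ler_pM2l P_gt0) mulrCA -(scaleD r0 lam_gt1) -/r.
  rewrite [r _](scaleS r0 lam_gt1) -/r.
  have := ler_wpM2r (ltW a_gt0) P_eps.
  have lam_gt0 : 0 < lam by exact: lt_trans lam_gt1.
  have := ler_wpM2l (ltW lam_gt0) (ltW iu_lt); lra.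
(* For larger [d], the level is that of [d] itself, and the hub lies on a shortest path, so there is
   no detour. *)
have [||k /andP[le_d]] := @scale_bracket _ lam r0 (fun x => x <= d).
- by exists (ring u + D)%N.
- by rewrite -ltNge -lte_fin -duv r0P // duv ltry.
rewrite -ltNge -/r => lt_d; have {}le_d : r k.+1 <= d by [].
have kD : (k <= ring u + D)%N.
  rewrite leqNgt; apply/negP => /ltnW/(scale_le lam_gt1 r0_gt0); rewrite -/r; lra.
exists k; split=> //.
  (* Otherwise [P * a <= r k.+1 <= d < q * a], against [P_ge]. *)
  rewrite leqNgt; apply/negP => /(scale_le lam_gt1 r0_gt0).
  rewrite -/r -addSn => le_i.
  have /(ler_wpM2l (ltW P_gt0)) := le_trans iu_ge le_i.
  rewrite -(scaleD r0 lam_gt1 k.+1 D) -/r => lt_P.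
  by have := ler_wpM2r (ltW a_gt0) P_ge; lra.
have [|x xl le_x] := local_hub_hit (v := v) lam_gt1 lam_le2 lam_c r0_gt0 X_hit
  near_u kD.
  by rewrite duv lee_fin lte_fin le_d.
have fin_ux : (dist u x <= d%:E)%E.
  by apply: le_trans uv_le; apply: le_trans le_x; rewrite leeDl // dist_ge0.
have fin_xv : (dist x v <= d%:E)%E.
  by apply: le_trans uv_le; apply: le_trans le_x; rewrite leeDr // dist_ge0.
exists x => //; exists (fine (dist u x)), (fine (dist x v)); split.
- by rewrite -(dist_fin fin_ux).
- by rewrite -(dist_fin fin_xv).
move: le_x; rewrite duv (dist_fin fin_ux) (dist_fin fin_xv) -EFinD lee_fin.
have := mulr_ge0 (ltW eps_gt0) a_ge0; rewrite /=; lra.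
Qed.

End Embedding.

(** For empty [S] the additive term is infinite, so only the lower bound on distances matters; the
    host graph without hubs has no edges. *)
Lemma edgeless_embedding (R : realType) (G : wgraph R) :
  exists (H : wgraph R) (phi : G -> H), [/\ injective phi, (treewidth H <= 0)%N
    & forall u v, (dist u v <= dist (phi u) (phi v))%E].
Proof.
pose none T (i : 'I_0) : T := False_rect T (notF (ltn_ord i)).
pose H := hub_graph (fun _ (_ : G) => tt) 0 (fun _ => ord0 : 'I_1) (none G)
  (fun _ _ => none G) (@ltr01 R).
exists H, (@hphi _ _ _ _ _ _ _ _ _ _ _ _ _); split.
- exact: hphi_inj.
- exact: treewidth_hub_graph.
- exact: dist_le_hub_graph.
Qed.

Theorem theorem4 (R : realType) :
  exists K : R, 0 < K /\
  forall c : R, 4 < c ->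
  exists f : nat -> nat -> R -> nat,
  forall eps : R, 0 < eps ->
  forall (G : wgraph R) (S : {set G}),
  exists (H : wgraph R) (phi : G -> H),
    [/\ injective phi,
        (treewidth H <= f (highway_dimension c G) #|S| eps)%N
      & forall u v : G,
          (dist u v <= dist (phi u) (phi v))%E /\
          (dist (phi u) (phi v) <=
             (1 + K * eps)%:E * dist u v
             + eps%:E * Order.min (set_dist S u) (set_dist S v))%E].
Proof.
exists 3; split=> // c c_gt4.
(* The ratio exceeds 1 exactly because [c > 4]. *)
pose lam := Order.min 2 ((c - 2) / 2).
have lam_gt1 : 1 < lam by rewrite lt_min; apply/andP; split; lra.
have lam_le2 : lam <= 2 by rewrite ge_min lexx.
have lam_c : 2 * lam <= c - 2.
  have : lam <= (c - 2) / 2 by rewrite ge_min lexx orbT.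
  lra.
(* [D] depends on [c] and [eps] only, so that [f] can be fixed before the graph. *)
have [D DP] :=
  choice (fun eps => expr_unbounded (4 * lam * (1 + eps^-1)) lam_gt1).
exists (fun eta s eps => s + (3 * D eps).+1 *
  ((D eps).+1 * (s.+1 * eta.+1 ^ (D eps).+1)))%N.
move=> eps eps_gt0 G S.
have [S0|] := posnP #|S|.
  have [H [phi [phi_inj tw le_phi]]] := edgeless_embedding G.
  exists H, phi; split=> // [|u v]; first exact: leq_trans tw _.
  split=> //; rewrite (cards0_eq S0) /set_dist !big_set0 minxx.
  rewrite gt0_muley ?lte_fin // addey ?leey //.
  rewrite -ltNye (@lt_le_trans _ _ 0%E) ?ltNy0 // mule_ge0 ?dist_ge0 //.
  by rewrite lee_fin; lra.
apply: (hub_embedding lam_gt1 lam_le2 lam_c eps_gt0 (DP eps)) => //.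
by rewrite /highway_dimension; case: ex_minnP => eta /asboolP.
Qed.
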